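(* There is an absolute constant $C>0$ such that the following holds. Let $\mathcal{G}=(G_1,\dots,G_T)$ be an always $S$-connected temporal graph on an $n$-vertex set $V$, let $m=|S|$, let $\Delta$ be the average degree of the underlying graph $U(\mathcal{G})$, and let $X\subseteq V$. If \[ T \;\ge\; C\, n\, m^{3}\, \Delta^{1.5}\, \sqrt{|X|\log\bigl(m|X|\bigr)}\,\log(|X|), \] then $X$ can be explored by $m$ agents, one agent starting on each vertex of $S$. (Logarithms of arguments smaller than $2$ are read as $1$.)
   Context: A temporal graph $\mathcal{G}=(G_1,\dots,G_T)$ on a finite vertex set $V$ is a sequence of simple undirected graphs (snapshots) $G_t=(V,E_t)$; $T$ is its lifetime. Its underlying graph is $U(\mathcal{G})=(V,\bigcup_{t}E_t)$, and the average degree is $\Delta=\frac1{|V|}\sum_{v\in V}\deg_{U(\mathcal{G})}(v)$. The graph is always $S$-connected, for $S\subseteq V$, if for every snapshot $G_t$ and every $v\in V$ there is some $u\in S$ joined to $v$ by a path in $G_t$. A temporal walk from $v$ to $u$ is a sequence $((v_0,v_1),t_1),\dots,((v_{\ell-1},v_\ell),t_\ell)$ with $v_0=v$, $v_\ell=u$, $\{v_{j-1},v_j\}\in E_{t_j}$ and $1\le t_1<t_2<\dots<t_\ell\le T$. The case $\ell=0$ is the trivial walk from $v$ to $v$. The agent following the walk may wait at a vertex between steps. The walk visits $v_0,\dots,v_\ell$. A set $X$ is explored by a collection of agents with given start vertices if each agent is assigned a temporal walk starting at its start vertex and every vertex of $X$ is visited by at least one of these walks. *)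

(* Defs.v *)
From mathcomp Require Import all_boot all_order all_algebra.
From mathcomp Require Import all_classical all_reals all_analysis.

Set Implicit Arguments.
Unset Strict Implicit.
Unset Printing Implicit Defensive.

Import Order.TTheory GRing.Theory Num.Theory.
Local Open Scope ring_scope.

Record sgraph (V : finType) := SGraph {
  edge :> rel V;
  edge_sym : symmetric edge;
  edge_irr : irreflexive edge }.

(* Times are numbered 0, ..., T-1 rather than 1, ..., T. *)
Definition temporal_graph (V : finType) (T : nat) := 'I_T -> sgraph V.

Section TemporalGraph.
Variables (V : finType) (T : nat) (G : temporal_graph V T).

Definition underlying : rel V := fun u v => [exists t, G t u v].

Definition degU (v : V) : nat := #|[set u | underlying v u]|.

Definition avg_degree (R : realType) : R :=
  (\sum_(v : V) (degU v)%:R) / #|V|%:R.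

Definition always_connected (S : {set V}) : Prop :=
  forall (t : 'I_T) (v : V), exists2 u : V, u \in S & connect (G t) v u.

(* The step ((x, y), t) traverses {x, y} from x to y in snapshot t. *)
Definition step : Type := ((V * V) * 'I_T)%type.

Fixpoint contiguous (v u : V) (w : seq step) : Prop :=
  match w with
  | [::] => v = u
  | ((x, y), t) :: w' => [/\ x = v, G t x y & contiguous y u w']
  end.

Definition temporal_walk (v u : V) (w : seq step) : Prop :=
  contiguous v u w /\ sorted ltn [seq val s.2 | s <- w].

Definition visited (v : V) (w : seq step) : seq V :=
  v :: [seq s.1.2 | s <- w].

Definition explored_by (A : finType) (start : A -> V) (X : {set V}) : Prop :=
  exists W : A -> seq step,
    (forall a, exists u, temporal_walk (start a) u (W a)) /\
    (forall x, x \in X -> exists a, x \in visited (start a) (W a)).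

End TemporalGraph.

Definition log_ (R : realType) (x : R) : R := if x < 2 then 1 else ln x.

(* Main.v *)
(** Cut time into windows. In a window [[a, b)], let [M_x(t)] be the set of vertices that [x]
    reaches by time [t] and that can still return to [x] after step [t]. The component of [x] in
    snapshot [t] contains an element of [S]; either that element lies in [M_x(t)], or some edge
    [u v] leaves [M_x(t)], and then [v] is new in the forward set of [x] or lost from its backward
    set. Charge [(x, t)] to the element of [S] or to the edge. Two vertices charged to the same
    object are joined by a walk within the window, in the order of the charging times, and each
    [x] is charged to an edge at most once per kind. Hence a window longer than twice the number
    of arcs returns every vertex to itself through [S], and shifting along the charge chains by
    at most [d] positions gives a sub-doubly-stochastic kernel on [X] with entries at most [1/d]
    that loses little mass.

    Composing such kernels, with [d] proportional to the largest power of two dividing the index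
    of the window, yields a random trajectory in [X] with few repetitions: any two times are
    separated by a window whose [d] is comparable to their distance. Interleaving it with [m + 1]
    long gaps, in each of which the agent can return to its place through some element of [S],
    two gaps use the same [s], so there is a closed walk from [s] that visits about
    [sqrt |X| / (m^2 log |X|)] vertices of [X] in time [O(m n Delta)]. Closed walks restore the
    starting positions, so they can be iterated until [X] is exhausted. *)

Require Import Defs.
From mathcomp Require Import all_boot all_order all_algebra.
From mathcomp Require Import all_classical all_reals all_analysis.
From mathcomp Require Import fintype finset zify ring lra.

Set Implicit Arguments.
Unset Strict Implicit.
Unset Printing Implicit Defensive.

Import Order.TTheory GRing.Theory Num.Theory.
Local Open Scope ring_scope.

(** * Temporal walks in time windows, and active vertices *)

Lemma connect_cut (V : finType) (e : rel V) (M : pred V) (x y : V) :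
  connect e x y -> M x -> ~~ M y -> exists u v, [/\ M u, ~~ M v & e u v].
Proof.
move=> /connectP[p]; elim: p x => [|z p IH] x /=; first by move=> _ -> ->.
move=> /andP[exz pz] yE Mx My.
have [Mz|Mz] := boolP (M z); first exact: IH Mz My.
by exists x, z.
Qed.

Section Walks.
Local Open Scope nat_scope.
Variables (V : finType) (T : nat) (G : temporal_graph V T).

(** Times are natural numbers, so that windows can be shifted freely; from time [T] on the relation
    is empty. *)
Definition adj (t : nat) (u v : V) : bool :=
  [exists t' : 'I_T, (val t' == t) && G t' u v].

(** [pairwise] splits directly over a concatenation. Windows are half-open, so consecutive ones
    share no time step. *)
Definition walk_within (a b : nat) (x y : V) (w : seq (step V T)) : Prop :=
  [/\ contiguous G x y w, pairwise ltn [seq val s.2 | s <- w]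
    & all (fun t => a <= t < b) [seq val s.2 | s <- w]].

(** [Z] holds only some of the visited vertices and may shrink; the empty [Z] leaves pure
    reachability, so both notions share one concatenation lemma. *)
Definition tour (a b : nat) (x y : V) (Z : {set V}) : Prop :=
  exists2 w, walk_within a b x y w & {subset Z <= visited x w}.

Definition reach (a b : nat) (x y : V) : Prop := tour a b x y set0.

Lemma adj_sym t u v : adj t u v = adj t v u.
Proof. by apply: eq_existsb => t'; rewrite edge_sym. Qed.

Lemma adj_underlying t u v : adj t u v -> underlying G u v.
Proof. by case/existsP=> t' /andP[_ e]; apply/existsP; exists t'. Qed.

Lemma contiguous_cat x y z w1 w2 :
  contiguous G x y w1 -> contiguous G y z w2 -> contiguous G x z (w1 ++ w2).
Proof.
elim: w1 x => [|[[u v] t] w1 IH] x /=; first by move=> ->.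
by move=> [-> e h] h2; split=> //; apply: IH h h2.
Qed.

Lemma walk_cat a b c x y z w1 w2 : a <= b -> b <= c ->
  walk_within a b x y w1 -> walk_within b c y z w2 -> walk_within a c x z (w1 ++ w2).
Proof.
move=> ab bc [c1 s1 /allP i1] [c2 s2 /allP i2]; split.
- exact: contiguous_cat c1 c2.
- rewrite map_cat pairwise_cat s1 s2 !andbT.
  apply/allrelP=> t t' /i1 /andP[_ tb] /i2 /andP[bt _].
  exact: leq_trans tb bt.
- rewrite map_cat all_cat; apply/andP; split; apply/allP=> t.
    by move=> /i1 /andP[-> tb]; exact: leq_trans tb bc.
  by move=> /i2 /andP[bt ->]; rewrite (leq_trans ab bt).
Qed.

Lemma tour_trans a b c x y z Z1 Z2 : a <= b -> b <= c ->
  tour a b x y Z1 -> tour b c y z Z2 -> tour a c x z (Z1 :|: Z2).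
Proof.
move=> ab bc [w1 h1 s1] [w2 h2 s2]; exists (w1 ++ w2).
  exact: walk_cat h1 h2.
(* The start [y] of the second walk survives in the concatenation only as the end of the first. *)
have yv : y \in visited x w1.
  case: h1 => h1 _ _; elim: w1 x h1 {s1} => [|[[u v] t] w1 IH] x /=.
    by move=> ->; rewrite inE.
  by move=> [_ _ /IH yin]; rewrite /visited /= inE yin orbT.
move=> v; rewrite inE => /orP[/s1|/s2].
  by rewrite /visited map_cat !inE mem_cat => /orP[->//|->]; rewrite orbT.
rewrite /visited inE => /orP[/eqP->|h].
  by move: yv; rewrite /visited map_cat !inE mem_cat => /orP[->//|->]; rewrite orbT.
by rewrite map_cat inE mem_cat h !orbT.
Qed.

Lemma tour_stay a b x : tour a b x x [set x].
Proof. by exists [::] => // v; rewrite !inE. Qed.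

Lemma tour_sub a b a' b' x y (Z Z' : {set V}) :
  a' <= a -> b <= b' -> Z' \subset Z -> tour a b x y Z -> tour a' b' x y Z'.
Proof.
move=> aa bb /subsetP ZZ [w [h1 h2 /allP h3] s]; exists w; last by move=> v /ZZ /s.
by split=> //; apply/allP=> t /h3 /andP[t1 t2]; rewrite (leq_trans aa t1) (leq_trans t2 bb).
Qed.

Lemma reach_refl a b x : reach a b x x.
Proof. exact: tour_sub (leqnn _) (leqnn _) (sub0set _) (tour_stay a b x). Qed.

Lemma reach_trans a b c x y z : a <= b -> b <= c ->
  reach a b x y -> reach b c y z -> reach a c x z.
Proof. by move=> ab bc h1 h2; rewrite /reach -[set0]setU0; apply: tour_trans h1 h2. Qed.

Lemma reach_sub a b a' b' x y : a' <= a -> b <= b' -> reach a b x y -> reach a' b' x y.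
Proof. by move=> h1 h2; apply: tour_sub. Qed.

Lemma reach_adj t u v : adj t u v -> reach t t.+1 u v.
Proof.
case/existsP=> t' /andP[/eqP tE e]; exists [:: ((u, v), t')]; last by move=> z; rewrite inE.
by split=> //=; rewrite tE leqnn ltnSn.
Qed.

(* Vertices isolated in the underlying graph lie in S and need no exploration; discarding them
   keeps the bounds valid when the average degree is below 1. *)
Definition active : {set V} := [set v | 0 < degU G v].

Definition num_arcs : nat := \sum_(v : V) degU G v.

Definition arcs : {set V * V} := [set e | underlying G e.1 e.2].

Lemma card_arcs : #|arcs| = num_arcs.
Proof.
rewrite /num_arcs (eq_bigr (fun v => \sum_(u | underlying G v u) 1)); last first.
  by move=> v _; rewrite /degU -sum1_card; apply: eq_bigl => u; rewrite inE.
rewrite (pair_big_dep predT (fun v u => underlying G v u) (fun _ _ => 1)) /= -sum1_card.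
by apply: eq_bigl => e; rewrite inE.
Qed.

Lemma card_active : #|active| <= num_arcs.
Proof.
rewrite -sum1_card /num_arcs [in leqRHS](bigID (mem active)) /=.
by apply: leq_trans (leq_addr _ _); apply: leq_sum => v; rewrite inE.
Qed.

Lemma active_underlying u v : underlying G u v -> v \in active.
Proof.
move=> /existsP[t e]; rewrite inE /degU card_gt0; apply/set0Pn; exists u.
by rewrite inE; apply/existsP; exists t; rewrite edge_sym.
Qed.

Lemma anchor (S : {set V}) t x : always_connected G S -> t < T ->
  exists2 s, s \in S & connect (adj t) x s.
Proof.
move=> GS tT; have [s sS cs] := GS (Ordinal tT) x; exists s => //.
apply: (connect_sub (e := G (Ordinal tT))) cs => u v e; apply: connect1.
by apply/existsP; exists (Ordinal tT); rewrite eqxx.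
Qed.

(** A path from an active to an inactive vertex would contain an edge with an inactive head, but
    both ends of an edge are active. *)
Lemma active_anchor (S : {set V}) t x : always_connected G S -> t < T -> x \in active ->
  exists2 s, s \in S :&: active & connect (adj t) x s.
Proof.
move=> GS tT xA; have [s sS cs] := anchor x GS tT; exists s => //; rewrite inE sS /=.
have [//|sA] := boolP (s \in active).
have [u [v [_ vA /adj_underlying]]] :=
  @connect_cut _ _ (fun v => v \in active) _ _ cs xA sA.
by move=> /active_underlying vA'; rewrite vA' in vA.
Qed.

(** In snapshot 0 the component of an inactive vertex is that vertex alone, so its anchor is the
    vertex itself. *)
Lemma inactive_anchor (S : {set V}) x : always_connected G S -> 0 < T -> x \notin active ->
  x \in S.
Proof.
move=> GS T0 xA; have [s sS cs] := anchor x GS T0.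
have [<-//|sx] := eqVneq s x.
have [u [v [/eqP-> _ e]]] := @connect_cut _ _ (fun v => v == x) _ _ cs (eqxx _) sx.
by rewrite adj_sym in e; rewrite (active_underlying (adj_underlying e)) in xA.
Qed.

End Walks.

(** * Charging each pair of a vertex and a time to an arc or an anchor *)

Section Escapes.
Local Open Scope nat_scope.
Variables (V : finType) (T : nat) (G : temporal_graph V T) (S : {set V}).
Hypothesis GS : always_connected G S.
Variables (a W : nat).
Hypothesis aWT : a + W <= T.

Local Notation adj := (adj G).
Local Notation reach := (reach G).
Let b := a + W.

(* A charge of (x, t): [inl (true, (u, v))] when v is new in the forward set of x,
   [inl (false, (u, v))] when v is lost from its backward set, [inr (t, s)] when s in S lies in
   M_x(t). *)
Definition ekey : Type := ((bool * (V * V)) + ('I_W * V))%type.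

Definition escape (x : V) (t : 'I_W) (k : ekey) : Prop :=
  match k with
  | inl (c, (u, v)) =>
      [/\ adj (a + t) u v, reach a (a + t) x u, reach (a + t).+1 b u x
        & if c then ~ reach a (a + t) x v else ~ reach (a + t).+1 b v x]
  | inr (t', s) =>
      [/\ t' = t, s \in S :&: active G, reach a (a + t) x s & reach (a + t).+1 b s x]
  end.

Lemma escape_exists x (t : 'I_W) : x \in active G -> exists k, escape x t k.
Proof.
move=> xA; have tT : a + t < T by apply: leq_trans aWT; rewrite ltn_add2l.
have [s sS cs] := active_anchor GS tT xA.
(* This is the set M_x(t). The head of an edge leaving it violates one of the two conditions, which
   decides the kind of the charge. *)
pose M v := `[< reach a (a + t) x v /\ reach (a + t).+1 b v x >].
have Mx : M x by apply/asboolP; split; apply: reach_refl.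
have [/asboolP[h1 h2]|Ms] := boolP (M s); first by exists (inr (t, s)).
have [u [v [/asboolP[h1 h2] Mv e]]] := connect_cut cs Mx Ms.
have [h|h] := pselect (reach a (a + t) x v); last by exists (inl (true, (u, v))).
exists (inl (false, (u, v))); split=> // h'.
by move/asboolP: Mv; apply.
Qed.

Lemma escape_reach_in x (t : 'I_W) c u v :
  escape x t (inl (c, (u, v))) -> reach a (a + t).+1 x v.
Proof.
move=> [e h _ _]; apply: (@reach_trans _ _ _ a (a + t) _ x u v) => //; first lia.
exact: reach_adj e.
Qed.

Lemma escape_reach_out x (t t' : 'I_W) c u v : t < t' ->
  escape x t' (inl (c, (u, v))) -> reach (a + t).+1 b v x.
Proof.
move=> tt [e _ h _]; have := ltn_ord t'; rewrite /b in h *.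
move=> tW; apply: (@reach_trans _ _ _ _ (a + t').+1 _ v u x) => //; try lia.
by rewrite adj_sym in e; apply: reach_sub (reach_adj e); lia.
Qed.

(** Suppose an arc [u v] is charged at [t < t']. Crossing it at [t] puts [v] in the forward set
    before [t'], so [v] is not new at [t']; crossing it back at [t'] lets [v] return after [t], so
    [v] is not lost at [t]. A charge to an anchor records its time. *)
Lemma escape_inj x (t t' : 'I_W) k : escape x t k -> escape x t' k -> t = t'.
Proof.
have key (t1 t2 : 'I_W) c u v : t1 < t2 -> escape x t1 (inl (c, (u, v))) ->
    escape x t2 (inl (c, (u, v))) -> False.
  move=> tt h1 h2; have h3 := escape_reach_out tt h2.
  have h4 : reach a (a + t2) x v by apply: reach_sub (escape_reach_in h1); lia.
  by move: h1 h2; case: c => -[_ _ _ h1] [_ _ _ h2].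
case: k => [[c [u v]]|[t'' s]]; last by move=> [-> _ _ _] [-> _ _ _].
move=> h1 h2; apply: val_inj; case: (ltngtP t t') => // tt.
- by have := key _ _ _ _ _ tt h1 h2.
- by have := key _ _ _ _ _ tt h2 h1.
Qed.

Lemma escape_reach x x' (t t' : 'I_W) k : t <= t' ->
  escape x t k -> escape x' t' k -> reach a b x x'.
Proof.
move=> tt; have tW := ltn_ord t; have tW' := ltn_ord t'.
case: k => [[c [u v]]|[t'' s]]; last first.
  move=> [<- _ h _] [<- _ _ h']; have tW'' := ltn_ord t''.
  apply: (@reach_trans _ _ _ a (a + t'').+1 _ x s x'); rewrite /b; try lia; last by [].
  by apply: (reach_sub _ _ h) => //; lia.
(* At equal times the edge cannot be crossed twice, and the walks are joined at [u]. Otherwise it is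
   crossed to [v] at [t] and back at [t']. *)
move: tt; rewrite leq_eqVlt => /orP[/eqP/val_inj<-|tt].
  move=> [_ h _ _] [_ _ h' _].
  apply: (@reach_trans _ _ _ a (a + t).+1 _ x u x'); rewrite /b; try lia; last by [].
  by apply: (reach_sub _ _ h) => //; lia.
move=> /escape_reach_in h /(escape_reach_out tt) h'.
by apply: (@reach_trans _ _ _ a (a + t).+1 _ x v x') => //; rewrite /b; lia.
Qed.

Definition ekeys : {set ekey} :=
  [set k | match k with
           | inl (_, (u, v)) => underlying G u v
           | inr (_, s) => s \in S :&: active G
           end].

Lemma escape_ekeys x t k : escape x t k -> k \in ekeys.
Proof.
by case: k => [[c [u v]]|[t'' s]]; rewrite in_set; [move=> [/adj_underlying]|move=> []].
Qed.

Lemma card_inl_ekeys : #|[set p : bool * (V * V) | inl p \in ekeys]| = 2 * num_arcs G.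
Proof.
rewrite -card_arcs -card_bool -cardsT -cardsX; apply: eq_card => -[c [u v]].
by rewrite !inE.
Qed.

Lemma card_ekeys : #|ekeys| = 2 * num_arcs G + W * #|S :&: active G|.
Proof.
rewrite -card_inl_ekeys -[in W * _](card_ord W) -cardsT -cardsX.
rewrite -(card_imset [set p | inl p \in ekeys] (@inl_inj _ ('I_W * V))).
rewrite -(card_imset (setX _ _) (@inr_inj (bool * (V * V)) _)).
rewrite -cardsUI [X in _ = _ + X](_ : _ = 0) ?addn0; last first.
  apply: eq_card0 => k; rewrite !inE; apply/negP=> /andP[/imsetP[p _ ->]].
  by move=> /imsetP[q _].
apply: eq_card => -[p|[t s]]; rewrite [in RHS]inE; apply/idP/orP.
- by move=> h; left; apply/imsetP; exists p => //; rewrite in_set.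
- by move=> [/imsetP[q +[->]]|/imsetP[q _ //]]; rewrite in_set.
- by move=> h; right; apply/imsetP; exists (t, s) => //; move: h; rewrite !inE.
- by move=> [/imsetP[q _ //]|/imsetP[[t' s'] + [-> ->]]]; rewrite !inE.
Qed.

(** Without a return through [S], every charge of [y] is to an arc. The [W] charges are distinct by
    [escape_inj], but only [2 * num_arcs G] arc charges exist. *)
Lemma gap_return y : y \in active G -> 2 * num_arcs G < W ->
  exists2 s, s \in S :&: active G & exists2 c, a <= c <= b & reach a c y s /\ reach c b s y.
Proof.
move=> yA EW; apply: contrapT => noret.
have [k kP] : {k : 'I_W -> ekey & forall t, escape y t (k t)}.
  by apply: (@choice _ _ (fun t k => escape y t k)) => t; apply: escape_exists.
have kinl t : exists p, k t = inl p.
  case: (k t) (kP t) => [p _|[t' s] [_ sS h1 h2]]; first by exists p.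
  case: noret; exists s => //; exists (a + t).+1; last by split=> //; apply: reach_sub h1.
  by have := ltn_ord t; rewrite /b; lia.
have [p pP] : {p : 'I_W -> bool * (V * V) & forall t, k t = inl (p t)}.
  exact: (@choice _ _ (fun t p => k t = inl p)).
have pinj : injective p.
  by move=> t t' ptt; apply: (@escape_inj y t t' (k t)) => //; rewrite pP ptt -pP.
have : #|p @: [set: 'I_W]| <= #|[set p : bool * (V * V) | inl p \in ekeys]|.
  apply/subset_leq_card/fintype.subsetP => q /imsetP[t _ ->]; rewrite in_set -pP.
  exact: escape_ekeys (kP t).
by rewrite card_imset // cardsT card_ord card_inl_ekeys leqNgt EW.
Qed.

End Escapes.

(** * Trajectories of sub-doubly-stochastic kernels *)

Section SubstochasticWalks.
Variables (R : realFieldType) (V : finType).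
Implicit Types (K : V -> V -> R) (Ks : seq (V -> V -> R)) (f : V -> R).

(** Row sums bound the mass of the trajectories from a point; column sums keep a density at most 1
    when it is pushed forward. *)
Record substochastic K : Prop := Substochastic {
  sub_ge0 : forall x y, 0 <= K x y;
  sub_row : forall x, \sum_y K x y <= 1;
  sub_col : forall y, \sum_x K x y <= 1 }.

(* The integral of F over the trajectories from x, where Ks lists the successive kernels. *)
Fixpoint path_int Ks (x : V) (F : seq V -> R) : R :=
  match Ks with
  | [::] => F [:: x]
  | K :: Ks' => \sum_y K x y * path_int Ks' y (fun p => F (x :: p))
  end.

Fixpoint supported Ks (p : seq V) : Prop :=
  match Ks, p with
  | [::], [:: _] => True
  | K :: Ks', x :: ((y :: _) as p') => K x y != 0 /\ supported Ks' p'
  | _, _ => False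
  end.

Fixpoint all_sub Ks : Prop :=
  if Ks is K :: Ks' then substochastic K /\ all_sub Ks' else True.

Lemma supported_nth Ks p z i K0 : supported Ks p -> (i < size Ks)%N ->
  nth K0 Ks i (nth z p i) (nth z p i.+1) != 0.
Proof.
elim: Ks p i => [|K Ks IH] [|x [|y p]] // [|i] /= [h1 h2] //; rewrite ltnS.
by move/(IH _ _ h2).
Qed.

Lemma eq_path_int Ks x F F' : (forall p, F p = F' p) -> path_int Ks x F = path_int Ks x F'.
Proof.
elim: Ks x F F' => [|K Ks IH] x F F' h //=; apply: eq_bigr => y _; congr (_ * _).
by apply: IH => p; apply: h.
Qed.

Lemma path_int_sum Ks x (I : Type) (r : seq I) (P : pred I) (F : I -> seq V -> R) :
  path_int Ks x (fun p => \sum_(i <- r | P i) F i p) = \sum_(i <- r | P i) path_int Ks x (F i).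
Proof.
elim: Ks x F => [|K Ks IH] x F //=; rewrite exchange_big /=; apply: eq_bigr => y _.
by rewrite IH mulr_sumr.
Qed.

Lemma path_int_const Ks x c : path_int Ks x (fun _ => c) = c * path_int Ks x (fun _ => 1).
Proof.
elim: Ks x => [|K Ks IH] x /=; first by rewrite mulr1.
by rewrite mulr_sumr; apply: eq_bigr => y _; rewrite IH mulrCA.
Qed.

Lemma path_int_ge0 Ks x F : all_sub Ks -> (forall p, 0 <= F p) -> 0 <= path_int Ks x F.
Proof.
elim: Ks x F => [|K Ks IH] x F //= [hK hs] hF; apply: sumr_ge0 => y _.
by rewrite mulr_ge0 ?sub_ge0 // IH.
Qed.

Lemma path_int_le Ks x F F' : all_sub Ks ->
  (forall q, supported Ks (x :: q) -> F (x :: q) <= F' (x :: q)) ->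
  path_int Ks x F <= path_int Ks x F'.
Proof.
elim: Ks x F F' => [|K Ks IH] x F F' /=; first by move=> _; apply.
move=> [hK hs] h; apply: ler_sum => y _.
have [->|Kn] := eqVneq (K x y) 0; first by rewrite !mul0r.
apply: ler_wpM2l; first exact: sub_ge0.
by apply: IH => // q hq; apply: h; split.
Qed.

Lemma path_int_le1 Ks x : all_sub Ks -> path_int Ks x (fun _ => 1) <= 1.
Proof.
elim: Ks x => [|K Ks IH] x //= [hK hs]; apply: le_trans (sub_row hK x).
by apply: ler_sum => y _; rewrite ler_piMr ?sub_ge0 ?IH.
Qed.

Lemma push_le1 K f y : substochastic K -> (forall x, 0 <= f x <= 1) ->
  0 <= \sum_x f x * K x y <= 1.
Proof.
move=> hK hf; apply/andP; split.
  by apply: sumr_ge0 => x _; rewrite mulr_ge0 ?sub_ge0 //; case/andP: (hf x).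
apply: le_trans (sub_col hK y); apply: ler_sum => x _.
by rewrite ler_piMl ?sub_ge0 //; case/andP: (hf x).
Qed.

(** Moves the first step from the trajectory into the initial density; the inductions that carry a
    density [f] rest on it. *)
Lemma push_path_int K Ks f F :
  \sum_x f x * path_int (K :: Ks) x (fun p => F (behead p)) =
  \sum_y (\sum_x f x * K x y) * path_int Ks y F.
Proof.
under [RHS]eq_bigr do rewrite mulr_suml.
rewrite [RHS]exchange_big /=; apply: eq_bigr => x _; rewrite mulr_sumr.
by apply: eq_bigr => y _; rewrite mulrA.
Qed.

Variable v0 : V.

(** The density at position [j] is still at most 1 by the column sums, and the kernels after [j]
    only lose mass. *)
Lemma col_path_int Ks f z j : all_sub Ks -> (forall x, 0 <= f x <= 1) ->
  (j <= size Ks)%N ->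
  \sum_x f x * path_int Ks x (fun p => (nth v0 p j == z)%:R) <= 1.
Proof.
elim: Ks f j => [|K Ks IH] f [|j] hs hf // jK.
- rewrite (bigD1 z) //= eqxx mulr1 big1 ?addr0; last by move=> x /negPf->; rewrite mulr0.
  by case/andP: (hf z).
- rewrite (bigD1 z) //= [X in _ + X]big1 ?addr0; last first.
    move=> x /negPf xz; rewrite big1 ?mulr0 // => y _.
    by rewrite xz path_int_const mul0r mulr0.
  rewrite eqxx; apply: mulr_ile1; case/andP: (hf z) => // _ _.
    exact: (@path_int_ge0 (K :: Ks) z (fun _ => 1)).
  exact: (@path_int_le1 (K :: Ks) z).
- case: hs => hK hs; rewrite (push_path_int K Ks f (fun p => (nth v0 p j == z)%:R)).
  by apply: IH => // y; apply: push_le1.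
Qed.

(** After kernel [w] the density is at most [d]. Column sums preserve this up to position [j]; row
    sums average it over the steps before [w]. *)
Lemma path_int_entry_le Ks d x z w j : all_sub Ks -> 0 <= d ->
  (w < j)%N -> (j <= size Ks)%N ->
  (forall K0 y y', nth K0 Ks w y y' <= d) ->
  path_int Ks x (fun p => (nth v0 p j == z)%:R) <= d.
Proof.
move=> + d0; elim: Ks w x j => [|K Ks IH] w x [|j] // [hK hs] wj jK hd.
rewrite /=; case: w wj hd => [_ /(_ K) hd|w wj hd].
  apply: le_trans (_ : \sum_y d * path_int Ks y (fun p => (nth v0 p j == z)%:R) <= _).
    apply: ler_sum => y _; apply: ler_wpM2r; last exact: hd.
    by apply: path_int_ge0.
  rewrite -mulr_sumr ler_piMr //.
  have := @col_path_int Ks (fun _ => 1) z j hs; rewrite ler01 lexx => /(_ (fun _ => isT) jK).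
  by under eq_bigr do rewrite mul1r.
apply: le_trans (_ : \sum_y K x y * d <= _).
  apply: ler_sum => y _; apply: ler_wpM2l; first exact: sub_ge0.
  exact: (IH w) (fun K0 => hd K0).
by rewrite -mulr_suml ler_piMl // sub_row.
Qed.

(** Pushed to position [i], [f] is a density at most 1 on [X]; from each vertex of [X], the mass
    that is back there at position [j] is at most [d]. *)
Lemma collision_le Ks (X : {set V}) f d i w j : all_sub Ks -> 0 <= d ->
  (forall x, 0 <= f x <= 1) -> (forall x, x \notin X -> f x = 0) ->
  (forall n K0 x y, (n < size Ks)%N -> y \notin X -> nth K0 Ks n x y = 0) ->
  (i <= w)%N -> (w < j)%N -> (j <= size Ks)%N ->
  (forall K0 y y', nth K0 Ks w y y' <= d) ->
  \sum_x f x * path_int Ks x (fun p => (nth v0 p i == nth v0 p j)%:R) <= #|X|%:R * d.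
Proof.
move=> + d0; elim: Ks f i w j => [|K Ks IH] f [|i] w [|j] // hs hf fX KX iw wj jK hd.
  apply: le_trans (_ : \sum_(x in X) d <= _); last by rewrite sumr_const mulr_natl.
  rewrite [leRHS]big_mkcond /=; apply: ler_sum => x _.
  case: ifPn => [xX|/fX->]; last by rewrite mul0r.
  have [f0 f1] := andP (hf x).
  apply: le_trans (_ : 1 * d <= _); last by rewrite mul1r.
  apply: ler_pM => //; first exact:
    (@path_int_ge0 (K :: Ks) x (fun p => (nth v0 p 0 == nth v0 p j.+1)%:R)).
  have := @path_int_entry_le (K :: Ks) d x x w j.+1 hs d0 wj jK hd.
  rewrite /=; congr (_ <= _); apply: eq_bigr => y _; congr (_ * _).
  by apply: eq_path_int => p; rewrite eq_sym.
case: hs => hK hs; case: w iw wj hd => // w iw wj hd.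
rewrite (push_path_int K Ks f (fun p => (nth v0 p i == nth v0 p j)%:R)).
apply: (IH _ _ w) => //.
- by move=> y; apply: push_le1.
- move=> y yX; rewrite big1 // => x _.
  by have /= -> // := KX 0%N K x y; rewrite mulr0.
- by move=> n K0 x y nK yX; apply: (KX n.+1).
Qed.

Lemma mass_ge Ks (X : {set V}) f : all_sub Ks ->
  (forall x, 0 <= f x <= 1) -> (forall x, x \notin X -> f x = 0) ->
  (forall n K0 x y, (n < size Ks)%N -> y \notin X -> nth K0 Ks n x y = 0) ->
  (\sum_x f x) - \sum_(K <- Ks) (#|X|%:R - \sum_(x in X) \sum_y K x y) <=
  \sum_x f x * path_int Ks x (fun _ => 1).
Proof.
elim: Ks f => [|K Ks IH] f.
  by move=> _ _ _ _; rewrite big_nil subr0; apply: ler_sum => x _; rewrite mulr1.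
move=> [hK hs] hf fX KX; rewrite (push_path_int K Ks f (fun _ => 1)).
apply: le_trans (IH _ hs _ _ _); first last.
- by move=> n K0 x y nK yX; apply: (KX n.+1).
- by move=> y yX; rewrite big1 // => x _; have /= -> // := KX 0%N K x y; rewrite mulr0.
- by move=> y; apply: push_le1.
rewrite big_cons opprD addrA lerD2r [leRHS]exchange_big /= lerBlDr.
rewrite -sum1_card natr_sum -sumrB big_mkcond /= [in X in _ + X]big_mkcond -big_split /=.
apply: ler_sum => x _; rewrite -mulr_sumr.
have := sub_row hK x; have /andP[f0 f1] := hf x.
case: ifPn => [_|/fX->]; last by rewrite mul0r addr0.
(* For [x] in [X] the claim is [(1 - g) * (1 - r) >= 0]: a density at most 1 loses at most the row
   deficit. *)
move: (\sum_y _) (f x) f0 f1 => r g; nra.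
Qed.

End SubstochasticWalks.

(** * A kernel that shifts along chains of events with a common key *)

Section ChainKernel.
Variables (R : realFieldType) (V : finType) (X : {set V}) (W d : nat).
Variables (Kt : finType) (key : V -> 'I_W -> Kt) (keys : {set Kt}).
Hypotheses (W_gt0 : (0 < W)%N) (d_gt0 : (0 < d)%N).
Hypothesis key_in : forall x t, x \in X -> key x t \in keys.
Hypothesis key_inj : forall x, x \in X -> injective (key x).

Let event : finType := (V * 'I_W)%type.
Let ekey (e : event) : Kt := key e.1 e.2.
Let earlier : rel event := fun e e' => (e.2 <= e'.2)%N.
Let chain (k : Kt) : seq event :=
  sort earlier (enum [set e : event | (e.1 \in X) && (ekey e == k)]).
Let pos (e : event) : nat := index e (chain (ekey e)).
(** An event passes to any of the next [d] events of its chain. Events of equal time still get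
    distinct positions from the sort. *)
Let succ : rel event := fun e e' =>
  [&& e.1 \in X, e'.1 \in X, ekey e == ekey e' & (pos e < pos e' <= pos e + d)%N].

Let mem_chain k e : (e \in chain k) = (e.1 \in X) && (ekey e == k).
Proof. by rewrite mem_sort mem_enum inE. Qed.

Let chain_uniq k : uniq (chain k).
Proof. by rewrite sort_uniq enum_uniq. Qed.

Let chain_mem e : e.1 \in X -> e \in chain (ekey e).
Proof. by move=> eX; rewrite mem_chain eX eqxx. Qed.

Let succ_earlier e e' : succ e e' -> (e.2 <= e'.2)%N.
Proof.
move=> /and4P[eX eX' /eqP kk /andP[pp _]].
have tr : transitive earlier by move=> x y z; apply: leq_trans.
have st : sorted earlier (chain (ekey e)) by apply: sort_sorted => x y; apply: leq_total.
apply: (sorted_ltn_index tr st); rewrite ?chain_mem // kk ?chain_mem //.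
by move: pp; rewrite /pos kk.
Qed.

Let card_succ_le e : (#|[set e' | succ e e']| <= d)%N.
Proof.
pose g (i : 'I_d) := nth e (chain (ekey e)) (pos e + i.+1).
rewrite -[leqRHS]card_ord -cardsT; apply: leq_trans (leq_imset_card g _).
apply/subset_leq_card/subsetP=> e'; rewrite inE => /and4P[eX eX' /eqP kk /andP[p1 p2]].
have lt : (pos e' - (pos e).+1 < d)%N by lia.
apply/imsetP; exists (Ordinal lt) => //; rewrite /g /= kk.
have -> : (pos e + (pos e' - (pos e).+1).+1)%N = pos e' by lia.
by rewrite /pos nth_index // chain_mem.
Qed.

Let card_pred_le e' : (#|[set e | succ e e']| <= d)%N.
Proof.
pose g (i : 'I_d) := nth e' (chain (ekey e')) (pos e' - i.+1).
rewrite -[leqRHS]card_ord -cardsT; apply: leq_trans (leq_imset_card g _).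
apply/subset_leq_card/subsetP=> e; rewrite inE => /and4P[eX eX' /eqP kk /andP[p1 p2]].
have lt : (pos e' - (pos e).+1 < d)%N by lia.
apply/imsetP; exists (Ordinal lt) => //; rewrite /g /= -kk.
have -> : (pos e' - (pos e' - (pos e).+1).+1)%N = pos e by lia.
by rewrite /pos nth_index // chain_mem.
Qed.

Let full (e : event) := (pos e + d < size (chain (ekey e)))%N.

Let card_succ_full e : e.1 \in X -> full e -> (d <= #|[set e' | succ e e']|)%N.
Proof.
move=> eX fe; pose g (i : 'I_d) := nth e (chain (ekey e)) (pos e + i.+1).
have lt (i : 'I_d) : (pos e + i.+1 < size (chain (ekey e)))%N.
  by apply: leq_ltn_trans fe; rewrite leq_add2l.
have gi : injective g.
  move=> i j /eqP; rewrite nth_uniq // => /eqP/addnI[ij]; exact: val_inj.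
rewrite -[leqLHS]card_ord -cardsT -(card_imset _ gi).
apply/subset_leq_card/subsetP=> e' /imsetP[i _ ->]; rewrite inE.
have := mem_nth e (lt i); rewrite -/(g i) mem_chain => /andP[gX /eqP gk].
rewrite /succ eX gX gk eqxx /= /pos gk /g index_uniq // -/(pos e).
by have := ltn_ord i; lia.
Qed.

(** The events that lack [d] successors are among the last [d] of their chains. *)
Let card_not_full :
  (#|[set e : event | (e.1 \in X) && ~~ full e]| <= #|keys| * d)%N.
Proof.
have [->|[e0 _]] := set_0Vmem [set e : event | (e.1 \in X) && ~~ full e].
  by rewrite cards0.
pose g (p : Kt * 'I_d) := nth e0 (chain p.1) (size (chain p.1) - p.2.+1).
rewrite -[in leqRHS](card_ord d) -cardsT -cardsX.
apply: leq_trans (leq_imset_card g _).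
apply/subset_leq_card/subsetP=> e; rewrite inE /full -leqNgt => /andP[eX nf].
have ps : (pos e < size (chain (ekey e)))%N by rewrite index_mem chain_mem.
have lt : (size (chain (ekey e)) - (pos e).+1 < d)%N by lia.
apply/imsetP; exists (ekey e, Ordinal lt); first by rewrite !inE key_in.
rewrite /g /=.
have -> : (size (chain (ekey e)) - (size (chain (ekey e)) - (pos e).+1).+1 = pos e)%N by lia.
by rewrite /pos nth_index // chain_mem.
Qed.

Let N (x y : V) : nat := \sum_t \sum_t' succ (x, t) (y, t').

Let N_row x : (\sum_y N x y <= W * d)%N.
Proof.
rewrite /N exchange_big /= -[in leqRHS](card_ord W) -sum_nat_const.
apply: leq_sum => t _; apply: leq_trans (card_succ_le (x, t)).
rewrite pair_bigA /= -sum1dep_card [leqRHS]big_mkcond /=.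
by rewrite leq_eqVlt; apply/orP; left; apply/eqP; apply: eq_bigr => -[y t'] _; case: succ.
Qed.

Let N_col y : (\sum_x N x y <= W * d)%N.
Proof.
rewrite /N; under eq_bigr do rewrite exchange_big /=.
rewrite exchange_big /= -[in leqRHS](card_ord W) -sum_nat_const.
apply: leq_sum => t _; apply: leq_trans (card_pred_le (y, t)).
rewrite pair_bigA /= -sum1dep_card [leqRHS]big_mkcond /=.
by rewrite leq_eqVlt; apply/orP; left; apply/eqP; apply: eq_bigr => -[x t'] _; case: succ.
Qed.

(** The time [t] fixes the key, and [y] has this key at most once, so each [t] contributes at most
    1. *)
Let N_entry x y : (N x y <= W)%N.
Proof.
rewrite /N -[leqRHS]card_ord -sum1_card; apply: leq_sum => t _.
have [/existsP[t0 s0]|/existsPn no] := boolP [exists t', succ (x, t) (y, t')]; last first.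
  by rewrite big1 // => t' _; case: succ (no t').
rewrite (bigD1 t0) //= s0 big1 ?addn0 // => t' tt.
apply/eqP; rewrite eqb0; apply: contra tt.
move: s0 => /and4P[_ yX /eqP k0 _] /and4P[_ _ /eqP k1 _].
by apply/eqP/(key_inj yX); rewrite -[LHS]k1 -[RHS]k0.
Qed.

Let N_total : (d * (#|X| * W) <= \sum_(x in X) \sum_y N x y + d * (#|keys| * d))%N.
Proof.
have -> : (\sum_(x in X) \sum_y N x y = \sum_(e : event | e.1 \in X) #|[set e' | succ e e']|)%N.
  under eq_bigr do rewrite /N exchange_big /=.
  rewrite pair_big /=; apply: eq_big => [[x t]|[x t] _] /=; first by rewrite andbT.
  rewrite pair_bigA /= -sum1dep_card [RHS]big_mkcond /=.
  by apply: eq_bigr => -[y t'] _; case: succ.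
have -> : (#|X| * W = #|[set e : event | e.1 \in X]|)%N.
  rewrite -[in LHS](card_ord W) -cardsT -cardsX; apply: eq_card => -[x t].
  by rewrite !inE andbT.
rewrite -(cardsID [set e | full e]) mulnDr; apply: leq_add; last first.
  rewrite leq_mul2l; apply/orP; right; apply: leq_trans card_not_full.
  by apply/subset_leq_card/subsetP=> e; rewrite !inE andbC.
rewrite mulnC -sum_nat_const [leqRHS](bigID full) /=.
apply: leq_trans (leq_addr _ _).
rewrite (eq_bigl (fun e : event => (e.1 \in X) && full e)); last by move=> e; rewrite !inE.
by apply: leq_sum => e /andP[eX fe]; apply: card_succ_full.
Qed.

Lemma chain_kernel : exists K : V -> V -> R,
  [/\ substochastic K, forall x y, K x y <= d%:R^-1, forall x y, y \notin X -> K x y = 0,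
      #|X|%:R - \sum_(x in X) \sum_y K x y <= d%:R * (#|keys|%:R / W%:R)
    & forall x y, K x y != 0 ->
        [/\ x \in X, y \in X & exists t t' : 'I_W, (t <= t')%N /\ key x t = key y t']].
Proof.
have W0 : 0 < W%:R :> R by rewrite ltr0n.
have d0 : 0 < d%:R :> R by rewrite ltr0n.
have Wd0 : 0 < W%:R * d%:R :> R by rewrite mulr_gt0.
(* A uniform time among [W], then a uniform shift by 1 to [d] positions along the chain; a shift
   past its end loses its mass. *)
exists (fun x y => (N x y)%:R / (W%:R * d%:R)); split.
- split=> [x y|x|y]; first by rewrite divr_ge0 // ltW.
  + by rewrite -mulr_suml ler_pdivrMr // mul1r -natr_sum -natrM ler_nat.
  + by rewrite -mulr_suml ler_pdivrMr // mul1r -natr_sum -natrM ler_nat.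
- move=> x y; rewrite ler_pdivrMr // mulrCA mulVf ?gt_eqF // mulr1.
  by rewrite ler_nat.
- move=> x y yX; rewrite /N !big1 ?mul0r // => t _; rewrite big1 // => t' _.
  by apply/eqP; rewrite eqb0; apply: contra yX => /and4P[].
- under eq_bigr do rewrite -mulr_suml -natr_sum.
  rewrite -mulr_suml -natr_sum lerBlDr.
  have := N_total; rewrite -(ler_nat R) natrD !natrM.
  move: (_%:R : R) => s h.
  have -> : d%:R * (#|keys|%:R / W%:R) + s / (W%:R * d%:R) =
      (s + d%:R * (#|keys|%:R * d%:R)) / (W%:R * d%:R) :> R.
    by field; rewrite !gt_eqF.
  rewrite ler_pdivlMr //; apply: le_trans h; rewrite le_eqVlt; apply/orP; left.
  by apply/eqP; ring.
- move=> x y; rewrite mulf_eq0 negb_or => /andP[]; rewrite pnatr_eq0.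
  rewrite /N sum_nat_eq0 => /forallPn[t]; rewrite sum_nat_eq0 => /forallPn[t'].
  rewrite eqb0 negbK => h _; have := succ_earlier h.
  by case/and4P: h => xX yX /eqP kk _ tt; split=> //; exists t, t'.
Qed.

End ChainKernel.

(** * The ruler sequence *)

Section Ruler.
Local Open Scope nat_scope.

(** The largest power of two dividing [n.+1]; the successor allows numbering from 0. *)
Definition ruler (n : nat) : nat := 2 ^ logn 2 n.+1.

Lemma ruler_gt0 n : 0 < ruler n.
Proof. by rewrite expn_gt0. Qed.

(** The last multiple of [2 ^ h] up to [j] exceeds [i], since [2 ^ h <= j - i]; [w] is its
    predecessor because of the shift in [ruler]. *)
Lemma ruler_between i j : i < j ->
  exists2 w, i <= w < j & 2 ^ trunc_log 2 (j - i) <= ruler w.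
Proof.
move=> ij; have ji : 0 < j - i by rewrite subn_gt0.
set h := trunc_log 2 (j - i); have hle : 2 ^ h <= j - i := trunc_logP (isT : 1 < 2) ji.
have q0 : 0 < 2 ^ h by rewrite expn_gt0.
have lem := ltn_ceil j q0; have le := leq_divM j (2 ^ h).
exists (j %/ 2 ^ h * 2 ^ h).-1; first lia.
rewrite /ruler leq_exp2l // prednK; last lia.
by rewrite -pfactor_dvdn //; [exact: dvdn_mull | lia].
Qed.

Lemma sum_dvdn q N : \sum_(n < N) (q %| n.+1) = N %/ q.
Proof.
elim: N => [|N IH]; first by rewrite big_ord0 div0n.
rewrite big_ord_recr /= IH; case: q {IH} => [|q]; last by rewrite divnS // addnC.
by rewrite dvd0n.
Qed.

(** Replace each term by the sum of all powers [2 ^ h] dividing [n.+1]; every level [h] then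
    contributes at most [N]. *)
Lemma sum_ruler N : \sum_(n < N) ruler n <= N * (trunc_log 2 N).+1.
Proof.
set H := (trunc_log 2 N).+1.
apply: (@leq_trans (\sum_(n < N) \sum_(h < H) 2 ^ h * (2 ^ h %| n.+1))).
  apply: leq_sum => n _.
  have lt : logn 2 n.+1 < H.
    rewrite ltnS; apply: trunc_log_max => //.
    by apply: leq_trans (ltn_ord n); apply/dvdn_leq/pfactor_dvdnn.
  by rewrite (bigD1 (Ordinal lt)) //= pfactor_dvdnn muln1 leq_addr.
rewrite exchange_big /= mulnC -[in leqRHS](card_ord H) -sum_nat_const.
by apply: leq_sum => h _; rewrite -big_distrr /= sum_dvdn mulnC leq_divM.
Qed.

End Ruler.

(** * Existence of a trajectory with few repetitions *)

Section FewCollisions.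
Variable R : realFieldType.

(** Each dyadic block contributes exactly 1. *)
Lemma sum_inv_trunc_log h :
  \sum_(1 <= n < 2 ^ h) ((2 ^ trunc_log 2 n)%:R : R)^-1 = h%:R.
Proof.
elim: h => [|h IH]; first by rewrite expn0 big_geq.
have le : (2 ^ h <= 2 ^ h.+1)%N by rewrite leq_exp2l.
rewrite (big_cat_nat (n := 2 ^ h)) ?expn_gt0 //= IH -natr1; congr (_ + _).
rewrite (eq_big_nat _ _ (F2 := fun _ => ((2 ^ h)%:R : R)^-1)).
  rewrite sumr_const_nat expnS mul2n -addnn addnK.
  by rewrite -[_ *+ _]mulr_natl mulfV // pnatr_eq0 -lt0n expn_gt0.
by move=> n nh; rewrite (@trunc_log_eq 2 h).
Qed.

Lemma sum_pairs_trunc_log N :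
  \sum_(j < N.+1) \sum_(i < j) ((2 ^ trunc_log 2 (j - i))%:R : R)^-1 <=
  N.+1%:R * (trunc_log 2 N).+1%:R.
Proof.
set H := (trunc_log 2 N).+1.
rewrite mulr_natl -[X in _ *+ X]card_ord -sumr_const; apply: ler_sum => j _.
rewrite -(big_mkord predT (fun i => ((2 ^ trunc_log 2 (j - i))%:R : R)^-1)).
rewrite big_nat_rev /= add0n.
rewrite (eq_big_nat _ _ (F2 := fun i => ((2 ^ trunc_log 2 i.+1)%:R : R)^-1)); last first.
  by move=> i ij; congr ((2 ^ trunc_log 2 _)%:R^-1); lia.
rewrite -(big_add1 _ _ 0 j.+1 predT (fun i => ((2 ^ trunc_log 2 i)%:R : R)^-1)).
rewrite -(sum_inv_trunc_log H).
have le : (j.+1 <= 2 ^ H)%N.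
  by apply: (leq_trans (ltn_ord j)); apply: trunc_log_ltn.
rewrite [leRHS](big_cat_nat (n := j.+1)) //= lerDl.
by apply: sumr_ge0 => i _; rewrite invr_ge0.
Qed.

Lemma all_sub_map (V : finType) (I : eqType) (s : seq I) (K : I -> V -> V -> R) :
  (forall i, i \in s -> substochastic (K i)) -> all_sub [seq K i | i <- s].
Proof.
elim: s => //= i s IH h; split; first by apply: h; rewrite inE eqxx.
by apply: IH => j js; apply: h; rewrite inE js orbT.
Qed.

(** First moment: starting from the counting measure on [X], at least half of the mass survives,
    while the integral of the number of collisions is at most [#|X| * (N + 1) * H / D]. If every
    supported trajectory from [X] broke the bound, the integral would be at least twice that. *)
Lemma few_collisions (V : finType) (X : {set V}) (v0 : V) (N D H : nat) (s : R)
    (K : nat -> V -> V -> R) :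
  (0 < #|X|)%N -> (0 < D)%N -> 0 <= s -> (trunc_log 2 N < H)%N ->
  (forall n, (n < N)%N -> [/\ substochastic (K n),
     forall x y, K n x y <= (D * ruler n)%:R^-1,
     forall x y, y \notin X -> K n x y = 0
   & #|X|%:R - \sum_(x in X) \sum_y K n x y <= (D * ruler n)%:R * s]) ->
  2 * D%:R * s * N%:R * H%:R <= #|X|%:R ->
  exists p, [/\ supported (mkseq K N) p, head v0 p \in X &
    ((\sum_(j < N.+1) \sum_(i < j) (nth v0 p i == nth v0 p j)) * D < 4 * N.+1 * H)%N].
Proof.
move=> X0 D0 s0 NH hK hX; set Ks := mkseq K N.
pose coll p : nat := (\sum_(j < N.+1) \sum_(i < j) (nth v0 p i == nth v0 p j))%N.
apply: contrapT => no.
have D0r : 0 < D%:R :> R by rewrite ltr0n.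
have X0r : 0 < #|X|%:R :> R by rewrite ltr0n.
have H0r : 0 < H%:R :> R by rewrite ltr0n (leq_trans _ NH).
have hs : all_sub Ks.
  by apply: all_sub_map => n; rewrite mem_iota add0n => /hK[].
pose f x : R := (x \in X)%:R.
have f01 x : 0 <= f x <= 1 by rewrite /f; case: (x \in X); rewrite ?lexx ler01.
have fX x : x \notin X -> f x = 0 by rewrite /f => /negPf->.
have KX n K0 x y : (n < size Ks)%N -> y \notin X -> nth K0 Ks n x y = 0.
  by rewrite size_mkseq => nN yX; rewrite nth_mkseq //; case: (hK n nN) => _ _ ->.
have fsum : \sum_x f x = #|X|%:R.
  by rewrite -sum1_card natr_sum [RHS]big_mkcond; apply: eq_bigr => x _; rewrite /f; case: ifP.
have mass : #|X|%:R / 2 <= \sum_x f x * path_int Ks x (fun _ => 1).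
  apply: le_trans (mass_ge hs f01 fX KX); rewrite fsum.
  have : \sum_(L <- Ks) (#|X|%:R - \sum_(x in X) \sum_y L x y) <= D%:R * s * N%:R * H%:R.
    have -> : Ks = map K (index_iota 0 N) by rewrite /index_iota subn0.
    rewrite big_map big_mkord.
    apply: le_trans (_ : \sum_(n < N) (D * ruler n)%:R * s <= _).
      by apply: ler_sum => n _; case: (hK n (ltn_ord n)).
    rewrite -mulr_suml -natr_sum -big_distrr /= natrM -!mulrA ler_wpM2l ?ler0n // mulrC.
    rewrite ler_wpM2l // -natrM ler_nat; apply: leq_trans (sum_ruler N) _.
    by rewrite leq_mul2l NH orbT.
  by lra.
have up : \sum_x f x * path_int Ks x (fun p => (coll p)%:R) <= #|X|%:R * (N.+1%:R * H%:R / D%:R).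
  have -> : \sum_x f x * path_int Ks x (fun p => (coll p)%:R) =
      \sum_(j < N.+1) \sum_(i < j)
        \sum_x f x * path_int Ks x (fun p => (nth v0 p i == nth v0 p j)%:R).
    under eq_bigr => x _.
      rewrite (@eq_path_int _ _ _ _ _ (fun p => \sum_(j < N.+1) \sum_(i < j)
        (nth v0 p i == nth v0 p j)%:R)); last first.
        by move=> p; rewrite natr_sum; apply: eq_bigr => j _; rewrite natr_sum.
      rewrite path_int_sum mulr_sumr.
      under eq_bigr => j _ do rewrite path_int_sum mulr_sumr.
      over.
    by rewrite exchange_big /=; apply: eq_bigr => j _; rewrite exchange_big.
  apply: le_trans (_ : \sum_(j < N.+1) \sum_(i < j)
      #|X|%:R * (D%:R^-1 * (2 ^ trunc_log 2 (j - i))%:R^-1) <= _).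
    apply: ler_sum => j _; apply: ler_sum => i _.
    have [w /andP[iw wj] hw] := ruler_between (ltn_ord i).
    have wN : (w < N)%N by apply: leq_trans wj _; rewrite -ltnS.
    have d0 : 0 <= D%:R^-1 * (2 ^ trunc_log 2 (j - i))%:R^-1 :> R.
      by rewrite mulr_ge0 ?invr_ge0.
    apply: (@collision_le _ _ v0 Ks X f _ i w j) => //.
    - by rewrite size_mkseq -ltnS.
    - move=> K0 y y'; rewrite nth_mkseq //; case: (hK w wN) => _ h _ _.
      apply: le_trans (h y y') _; rewrite -invfM -natrM lef_pV2 ?posrE ?ltr0n ?muln_gt0 ?D0 //.
      + by rewrite ler_nat leq_mul2l hw orbT.
      + exact: ruler_gt0.
      + by rewrite expn_gt0.
  under eq_bigr => j _ do rewrite -mulr_sumr -mulr_sumr.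
  rewrite -mulr_sumr -mulr_sumr ler_wpM2l ?ler0n // mulrC ler_wpM2r ?invr_ge0 //.
  apply: le_trans (sum_pairs_trunc_log N) _.
  by rewrite ler_wpM2l ?ler0n // ler_nat.
have low : \sum_x f x * ((4 * N.+1%:R * H%:R / D%:R) * path_int Ks x (fun _ => 1)) <=
    \sum_x f x * path_int Ks x (fun p => (coll p)%:R).
  apply: ler_sum => x _; rewrite /f; have [xX|_] := boolP (x \in X); last by rewrite !mul0r.
  rewrite !mul1r -path_int_const; apply: path_int_le => // q hq.
  rewrite ler_pdivrMr // -!natrM ler_nat leqNgt; apply/negP => h.
  by apply: no; exists (x :: q).
have := le_trans low up.
rewrite (eq_bigr (fun x => (4 * N.+1%:R * H%:R / D%:R) * (f x * path_int Ks x (fun _ => 1))));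
  last by move=> x _; rewrite mulrCA.
rewrite -mulr_sumr; apply/negP; rewrite -ltNge.
have c0 : 0 < N.+1%:R * H%:R / D%:R :> R by rewrite divr_gt0 // mulr_gt0 // ltr0n.
have -> : 4 * N.+1%:R * H%:R / D%:R = 4 * (N.+1%:R * H%:R / D%:R) :> R by rewrite -!mulrA.
move: (_ / _) (\sum_x _) c0 mass {up low} => c M c0 mass; nra.
Qed.

End FewCollisions.

(** * Closed tours through an anchor *)

Section ClosedTours.
Variables (V : finType) (T : nat) (G : temporal_graph V T).
Variable S : {set V}.
Hypothesis GS : always_connected G S.

Local Notation m := #|S :&: active G|.
Local Notation E := (num_arcs G).

Lemma window_kernel (R : realFieldType) a W d (X : {set V}) : (a + W <= T)%N -> (0 < W)%N -> (0 < d)%N ->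
  X \subset active G -> exists K : V -> V -> R,
  [/\ substochastic K, forall x y, K x y <= d%:R^-1, forall x y, y \notin X -> K x y = 0,
      #|X|%:R - \sum_(x in X) \sum_y K x y <= d%:R * (m%:R + (2 * E)%:R / W%:R)
    & forall x y, K x y != 0 -> y \in X /\ reach G a (a + W) x y].
Proof.
move=> aWT W0 d0 /fintype.subsetP XA.
have ex (e : V * 'I_W) : exists k : ekey V W, e.1 \in X -> escape G S a e.1 e.2 k.
  have [/XA eA|_] := boolP (e.1 \in X); last by exists (inr (e.2, e.1)).
  by have [k h] := escape_exists GS aWT e.2 eA; exists k.
have [key keyP] := choice ex.
have [||||K [h1 h2 h3 h4 h5]] := @chain_kernel R V X W d _ (fun x t => key (x, t))
  (ekeys G S W) => //.
- by move=> x t xX; apply: escape_ekeys (keyP (x, t) xX).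
- move=> x xX t t' /= kk; have h1 := keyP (x, t) xX; have h2 := keyP (x, t') xX.
  by rewrite -kk in h2; apply: escape_inj h1 h2.
exists K; split=> //.
  have Wn0 : W%:R != 0 :> R by rewrite pnatr_eq0 -lt0n.
  by apply: le_trans h4 _; rewrite card_ekeys natrD (natrM _ W) addrC mulrDl mulrAC mulfV ?mul1r.
move=> x y /h5[xX yX [t [t' [tt kk]]]]; split=> //.
have h := keyP (y, t') yX; rewrite -kk in h.
exact: escape_reach tt (keyP (x, t) xX) h.
Qed.

Local Open Scope nat_scope.

(** The conditions on [c] and [e] assume [0 < r] because a path without steps uses no window;
    [closed_tour] meets this case when [L = 0]. *)
Lemma tour_path (al : nat -> nat) (W N : nat) (p : nat -> V) r i c e :
  {homo al : k l / k <= l} -> (forall n, al n + W <= al n.+1) ->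
  (forall n, n < N -> reach G (al n) (al n + W) (p n) (p n.+1)) ->
  c <= e -> (0 < r -> c <= al i) -> (0 < r -> al (i + r).-1 + W <= e) -> i + r <= N ->
  tour G c e (p i) (p (i + r)) [set p (i + q) | q : 'I_r.+1].
Proof.
move=> almono alW pP; elim: r i c => [|r IH] i c ce ci re iN.
  rewrite addn0; apply: tour_sub (tour_stay G c e (p i)) => //.
  by apply/fintype.subsetP => v /imsetP[q _ ->]; rewrite (ord1 q) addn0 inE.
have {}ci := ci isT; have {}re := re isT; rewrite addnS /= in re.
have le1 : al i + W <= e by apply: leq_trans re; rewrite leq_add2r almono ?leq_addr.
have t2 : tour G (al i + W) e (p i.+1) (p (i.+1 + r)) [set p (i.+1 + q) | q : 'I_r.+1].
  by apply: IH => //; rewrite addSn // -addnS.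
have t1 : tour G c (al i + W) (p i) (p i.+1) ([set p i] :|: set0).
  apply: (tour_trans (b := al i)) => //; first exact: leq_addr.
    exact: tour_stay.
  by apply: pP; lia.
have ci' : c <= al i + W by lia.
rewrite -addSnnS; apply: (tour_sub _ _ _ (tour_trans ci' le1 t1 t2)) => //.
apply/fintype.subsetP => v /imsetP[q _ ->]; rewrite setU0 !inE.
case: (unliftP ord0 q) => [q' ->|->]; last by rewrite addn0 eqxx.
by apply/orP; right; apply/imsetP; exists q' => //; rewrite addSnnS.
Qed.

Lemma sum_shift_le (F : nat -> nat) i r N : i + r <= N ->
  \sum_(q < r.+1) F (i + q) <= \sum_(l < N.+1) F l.
Proof.
move=> irN; have le0 : i <= N.+1 by lia.
have le3 : i + r.+1 <= N.+1 by lia.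
rewrite -(big_mkord predT F) (big_cat_nat (n := i)) //=.
rewrite [X in _ <= _ + X](big_cat_nat (n := i + r.+1)) ?leq_addr //=.
rewrite addnCA -[leqLHS]addn0 leq_add // -{2}[i]add0n big_addn addKn big_mkord.
by under eq_bigr do rewrite addnC.
Qed.

(** A position whose vertex occurred earlier accounts for a collision; the other positions, [J],
    carry distinct vertices. *)
Lemma distinct_ge (p : nat -> V) (i r N : nat) : i + r <= N ->
  r < #|[set p (i + q) | q : 'I_r.+1]| + \sum_(l < N.+1) \sum_(n < l) (p n == p l).
Proof.
move=> irN; pose rep (q : 'I_r.+1) := [exists n : 'I_(i + q), p n == p (i + q)].
pose J := [set q | ~~ rep q].
have Jinj : {in J &, injective (fun q : 'I_r.+1 => p (i + q))}.
  have key (q q' : 'I_r.+1) : q' \in J -> p (i + q) = p (i + q') -> ~~ (q < q').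
    rewrite inE => /existsPn no pp; apply/negP => qq.
    have lt : i + q < i + q' by rewrite ltn_add2l.
    by have := no (Ordinal lt); rewrite /= pp eqxx.
  move=> q q' qJ qJ' pp; apply: val_inj.
  have /negbTE h1 := key q q' qJ' pp; have /negbTE h2 := key q' q qJ (esym pp).
  by move: h1 h2; case: ltngtP.
have le1 : #|J| <= #|[set p (i + q) | q : 'I_r.+1]|.
  by rewrite -(card_in_imset Jinj); apply/subset_leq_card/imsetS; apply/fintype.subsetP.
have le2 : #|~: J| <= \sum_(l < N.+1) \sum_(n < l) (p n == p l).
  apply: (@leq_trans (\sum_(q < r.+1) (fun l => \sum_(n < l) (p n == p l)) (i + q))).
    rewrite -sum1_card big_mkcond /=; apply: leq_sum => q _.
    rewrite !inE negbK; case: ifP => // /existsP[n pn].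
    by rewrite (bigD1 n) //= pn.
  exact: (sum_shift_le (fun l => \sum_(n < l) (p n == p l))).
have := cardsC J; rewrite card_ord; lia.
Qed.

(** The schedule alternates [m + 1] gaps of length [g], long enough for [gap_return], with [m]
    blocks of [L] windows of length [W]. For [L > 0] the choice of [W] gives [2 * E / W <= L]; for
    [L = 0] the blocks are empty and [Z] is a single vertex. *)
Lemma closed_tour a L l (X : {set V}) (W := (2 * E %/ L).+1) (g := (2 * E).+1)
    (H := m.+1 * g + m * (L * W)) :
  X \subset active G -> 0 < #|X| -> trunc_log 2 #|X| < l ->
  (8 * m ^ 2 * l * L) ^ 2 <= #|X| -> a + H <= T ->
  exists s, exists Z : {set V},
    [/\ s \in S, Z \subset X, tour G a (a + H) s s Z & L < 2 * #|Z|].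
Proof.
move=> XA X0 Xl XL aHT.
have /card_gt0P[v0 v0X] := X0.
pose gap j := a + j * (L * W + g).
have gapT j : j <= m -> gap j + g <= a + H.
  by move=> jm; rewrite /gap /H; have := leq_mul jm (leqnn (L * W + g)); nia.
have ret y j : y \in X -> j <= m ->
    exists2 s, s \in S :&: active G & exists2 c, gap j <= c <= gap j + g &
      reach G (gap j) c y s /\ reach G c (gap j + g) s y.
  move=> yX jm; apply: (gap_return GS (leq_trans (gapT j jm) aHT)) => //.
  exact: (fintype.subsetP XA).
have m0 : 0 < m.
  by have [s sS _] := ret v0 0 v0X isT; apply/card_gt0P; exists s.
(* Window [n] lies in block [n %/ L], so [(n %/ L).+1] gaps precede it. *)
pose al n := a + n * W + (n %/ L).+1 * g.
have almono : {homo al : k n / k <= n}.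
  move=> k n kn; rewrite /al; apply: leq_add; first by rewrite leq_add2l leq_mul2r kn orbT.
  by rewrite leq_mul2r ltnS leq_div2r // orbT.
have alW n : al n + W <= al n.+1.
  rewrite /al mulSn; have := leq_mul (leq_div2r L (leqnSn n)) (leqnn g).
  by rewrite !mulSn; lia.
(* For [L > 0] we have [N + 1 <= 2 * m * L], so this [D] makes the collision bound
   [4 * (N + 1) * l / D] at most [L / 2]. *)
set N := m * L; set D := 16 * m * l.
have l0 : 0 < l by apply: leq_trans Xl.
have alT n : n < N -> al n + W <= T.
  move=> nN; apply: leq_trans aHT.
  have L0 : 0 < L by case: (posnP L) nN => // L0; rewrite /N L0 muln0.
  have q : n %/ L < m by rewrite ltn_divLR.
  rewrite /al /H -!addnA leq_add2l.
  have := leq_mul nN (leqnn W); have := leq_mul q (leqnn g); rewrite /N !mulSn mulnA; lia.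
(* The kernels serve only to find a trajectory, so rational entries suffice. *)
have exK n : exists K : V -> V -> rat, n < N ->
  [/\ substochastic K, forall x y, (K x y <= (D * ruler n)%:R^-1)%R,
      forall x y, y \notin X -> K x y = 0%R,
      (#|X|%:R - \sum_(x in X) \sum_y K x y <=
        (D * ruler n)%:R * (m%:R + (2 * E)%:R / W%:R))%R
    & forall x y, K x y != 0%R -> y \in X /\ reach G (al n) (al n + W) x y].
  have [nN|_] := ltnP n N; last by exists (fun _ _ => 0%R).
  have D0 : 0 < D * ruler n by rewrite !muln_gt0 ruler_gt0 m0 l0.
  by have [K hK] := window_kernel rat (alT n nN) (ltn0Sn _) D0 XA; exists K.
have [K hK] := choice exK.
have NX : N <= #|X|.
  apply: leq_trans XL; rewrite /N; set z := 8 * m ^ 2 * l * L.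
  apply: (@leq_trans z); last by rewrite expnS expn1; case: (z) => // z'; rewrite leq_pmulr.
  rewrite /z leq_mul2r; apply/orP; right.
  have -> : 8 * m ^ 2 * l = m * (8 * m * l) by ring.
  by rewrite leq_pmulr // !muln_gt0 m0 l0.
have mass : (2 * D%:R * (m%:R + (2 * E)%:R / W%:R) * N%:R * l%:R <= #|X|%:R :> rat)%R.
  have [L0|L0] := posnP L; first by rewrite /N L0 muln0 mulr0 mul0r.
  apply: (@le_trans _ _ (2 * D%:R * (m + L)%:R * N%:R * l%:R)%R).
    rewrite !ler_wpM2r // ler_wpM2l ?mulr_ge0 // natrD lerD2l ler_pdivrMr ?ltr0n //.
    by rewrite -natrM ler_nat (mulnC L) ltnW // ltn_ceil.
  rewrite -!natrM ler_nat; apply: leq_trans XL.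
  have -> : 2 * D * (m + L) * N * l = 32 * m ^ 2 * l ^ 2 * L * (m + L) by rewrite /D /N; ring.
  have -> : (8 * m ^ 2 * l * L) ^ 2 = 32 * m ^ 2 * l ^ 2 * L * (m * (m * L) + L * (m * m)) by ring.
  rewrite leq_mul2l; apply/orP; right.
  by apply: leq_add; rewrite leq_pmulr // muln_gt0 ?m0 ?L0.
have [p [psup phead pcoll]] : exists p, [/\ supported (mkseq K N) p, head v0 p \in X &
    (\sum_(j < N.+1) \sum_(i < j) (nth v0 p i == nth v0 p j)) * D < 4 * N.+1 * l].
  have D0 : 0 < D by rewrite !muln_gt0 m0 l0.
  have s0 : (0 <= m%:R + (2 * E)%:R / W%:R :> rat)%R by rewrite addr_ge0 // divr_ge0.
  have Nl : trunc_log 2 N < l by apply: leq_trans Xl; rewrite ltnS leq_trunc_log.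
  by apply: (few_collisions v0 X0 D0 s0 Nl _ mass) => n nN; case: (hK n nN).
pose q n := nth v0 p n.
have qstep n : n < N -> q n.+1 \in X /\ reach G (al n) (al n + W) (q n) (q n.+1).
  move=> nN; have [_ _ _ _] := hK n nN; apply.
  have := supported_nth v0 (K n) psup; rewrite size_mkseq => /(_ n nN).
  by rewrite nth_mkseq.
have qX n : n <= N -> q n \in X.
  by case: n => [_|n /qstep[]//]; rewrite /q nth0.
have coll2 : 2 * \sum_(j < N.+1) \sum_(i < j) (q i == q j) <= L.
  have [L0|L0] := posnP L.
    by rewrite /N L0 muln0 big_ord_recl !big_ord0.
  rewrite leqNgt; apply/negP => Lc; move: pcoll; apply/negP; rewrite -leqNgt.
  apply: (@leq_trans (8 * (m * l) * L)); last first.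
    have -> c0 : c0 * D = 8 * (m * l) * (2 * c0) by rewrite /D; ring.
    by rewrite leq_mul2l (ltnW Lc) orbT.
  have -> : 8 * (m * l) * L = 4 * (N + N) * l by rewrite /N; ring.
  by rewrite leq_mul2r leq_mul2l -[N.+1]addn1 leq_add2l muln_gt0 m0 L0 !orbT.
have exl (j : 'I_m.+1) : exists s, s \in S :&: active G /\
    exists2 c, gap j <= c <= gap j + g &
      reach G (gap j) c (q (j * L)) s /\ reach G c (gap j + g) s (q (j * L)).
  have jm : j <= m by rewrite -ltnS.
  have [|s h1 h2] := ret (q (j * L)) j _ jm; last by exists s.
  by apply: qX; rewrite leq_mul2r jm orbT.
have [lab labP] := choice exl.
have [i [j [ij lij]]] : exists i j : 'I_m.+1, i < j /\ lab i = lab j.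
  have /injectivePn[i [j ij lij]] : ~~ injectiveb lab.
    apply/injectiveP => inj; have : #|lab @: [set: 'I_m.+1]| <= m.
      by apply/subset_leq_card/fintype.subsetP => s /imsetP[j _ ->]; case: (labP j).
    by rewrite card_imset // cardsT card_ord ltnn.
  case: (ltngtP i j) => h; first by exists i, j.
  - by exists j, i.
  - by rewrite (val_inj h) eqxx in ij.
(* The closed walk uses the second half of the return in gap [i], from the anchor to the trajectory,
   and the first half of the return in gap [j], back to the same anchor. *)
have [iS [c /andP[c1 c2] [_ h1]]] := labP i; have [_ [c' /andP[c3 c4] [h2 _]]] := labP j.
have jm : j <= m by rewrite -ltnS.
have rE : i * L + (j - i) * L = j * L by rewrite -mulnDl subnKC // ltnW.
have jN : j * L <= N by rewrite leq_mul2r jm orbT.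
have gij : gap i + g <= gap j.
  rewrite /gap; have := leq_mul ij (leqnn (L * W + g)); rewrite mulSn; lia.
have t : tour G (gap i + g) (gap j) (q (i * L)) (q (j * L))
    [set q (i * L + r) | r : 'I_((j - i) * L).+1].
  rewrite -rE; apply: (tour_path (al := al) (W := W) (N := N)) => //.
  - by move=> n nN; case: (qstep n nN).
  - rewrite muln_gt0 => /andP[_ L0]; rewrite /gap /al mulnK // mulSn; lia.
  - rewrite muln_gt0 rE => /andP[_ L0]; rewrite /gap /al.
    have j0 : 0 < j by apply: leq_ltn_trans ij.
    have jL0 : 0 < j * L by rewrite muln_gt0 j0.
    have lt : (j * L).-1 %/ L < j by rewrite ltn_divLR // prednK.
    have := leq_mul lt (leqnn g); have := prednK jL0.
    move: (j * L).-1 => z zE; rewrite mulnDr mulnA -zE mulSn; lia.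
  - by rewrite rE.
exists (lab i), [set q (i * L + r) | r : 'I_((j - i) * L).+1]; split.
- by case/setIP: iS.
- apply/fintype.subsetP => v /imsetP[r _ ->]; apply: qX; apply: leq_trans jN.
  by rewrite -rE leq_add2l -ltnS.
- have h3 := tour_trans c2 gij h1 t.
  rewrite -lij in h2; have le : c <= gap j by apply: leq_trans gij.
  have h4 := tour_trans le c3 h3 h2.
  apply: tour_sub h4.
  + by apply: leq_trans c1; apply: leq_addr.
  + exact: leq_trans (gapT j jm).
  + by rewrite set0U setU0.
have := @distinct_ge q (i * L) ((j - i) * L) N; rewrite rE => /(_ jN).
have : L <= (j - i) * L by rewrite leq_pmull // subn_gt0.
by move: coll2; set co := \sum_(_ < _) _; lia.
Qed.

End ClosedTours.

(** * Exhausting a set by closed tours *)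

Section Sweep.
Local Open Scope nat_scope.
Variables (V : finType) (T : nat) (G : temporal_graph V T) (S : {set V}).
Hypothesis GS : always_connected G S.

Local Notation m := #|S :&: active G|.
Local Notation E := (num_arcs G).
Hypothesis m_gt0 : 0 < m.

Variable l : nat.
Let Q := 16 * m ^ 2 * l.

(** For the largest [L] with [(P * L) ^ 2 <= #|X|], the tour has [L < 2 * #|Z|]. Maximality then
    gives the bound, with [Q = 2 * P]. *)
Lemma batch a (X : {set V}) :
  X \subset active G -> 0 < #|X| -> trunc_log 2 #|X| < l -> a + 9 * m * E <= T ->
  exists s, exists Z : {set V},
    [/\ s \in S, Z \subset X, tour G a (a + 9 * m * E) s s Z & #|X| <= (Q * #|Z|) ^ 2].
Proof.
move=> XA X0 Xl aT; have l0 : 0 < l by apply: leq_trans Xl.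
set P := 8 * m ^ 2 * l; have P0 : 0 < P by rewrite !muln_gt0 m_gt0 l0.
have PL L : (P * L) ^ 2 <= #|X| -> L <= #|X|.
  move=> h; apply: leq_trans h; apply: (@leq_trans (P * L)); first by rewrite leq_pmull.
  by rewrite expnS expn1; case: (P * L) => // z; rewrite leq_pmulr.
have ex : exists L, (P * L) ^ 2 <= #|X| by exists 0; rewrite muln0.
case: (ex_maxnP ex PL) => L hL Lmax.
have XE : #|X| <= E by apply: leq_trans (subset_leq_card XA) (card_active G).
have LE : L <= E by apply: leq_trans (PL L hL) XE.
(* The gaps take at most [6 * m * E] and the windows at most [3 * m * E], as [m] and [E] are
   positive. *)
have le : m.+1 * (2 * E).+1 + m * (L * (2 * E %/ L).+1) <= 9 * m * E.
  have h1 : L * (2 * E %/ L).+1 <= 3 * E by rewrite mulnS mulnC; have := leq_divM (2 * E) L; lia.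
  have h2 : m.+1 * (2 * E).+1 <= (2 * m) * (3 * E) by apply: leq_mul; lia.
  have := leq_mul (leqnn m) h1; move: h2; lia.
have aT' : a + (m.+1 * (2 * E).+1 + m * (L * (2 * E %/ L).+1)) <= T.
  by apply: leq_trans aT; rewrite leq_add2l.
have [s [Z [sS ZX t LZ]]] := closed_tour GS XA X0 Xl hL aT'.
exists s, Z; split=> //; first by apply: tour_sub t; rewrite ?leq_add2l.
rewrite leqNgt; apply/negP => h.
have : L.+1 <= L; last by rewrite ltnn.
apply: Lmax; apply: leq_trans (ltnW h); rewrite leq_exp2r //.
have -> : Q * #|Z| = P * (2 * #|Z|) by rewrite /Q /P; ring.
by rewrite leq_mul2l LZ orbT.
Qed.

(* With A = Q^2, b plays the role of 2 Q sqrt k, which drops by 1 when r >= sqrt k / Q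
   vertices are visited. *)
Lemma square_descent A k r b :
  4 * A * k <= b.+1 ^ 2 -> k <= A * r ^ 2 -> 4 * A * (k - r) <= b ^ 2.
Proof.
move=> hb hk; have [//|lt] := leqP (4 * A * k) (b ^ 2).
  by apply: leq_trans; rewrite leq_mul2l leq_subr orbT.
have {}hk : 4 * A * k <= (2 * A * r) ^ 2.
  have -> : (2 * A * r) ^ 2 = 4 * A * (A * r ^ 2) by ring.
  by rewrite leq_mul2l hk orbT.
have : b < 2 * A * r by rewrite -(ltn_exp2r _ _ (e := 2)) // (leq_trans lt).
by rewrite mulnBr; move: hb; rewrite -[b.+1]addn1 sqrnD; lia.
Qed.

(** In each of at most [b] rounds one agent makes a closed tour while the others wait, so all agents
    are back at their starts for the next round. *)
Lemma sweep b : forall a (X : {set V}),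
  X \subset active G -> trunc_log 2 #|X| < l -> 4 * Q ^ 2 * #|X| <= b ^ 2 ->
  a + 9 * m * E * b <= T ->
  exists W : V -> seq (step V T),
    (forall s, s \in S -> exists u, walk_within G a T s u (W s)) /\
    (forall x, x \in X -> exists2 s, s \in S & x \in visited s (W s)).
Proof.
elim: b => [|b IH] a X XA Xl hb aT; have [->|X0] := set_0Vmem X.
- by exists (fun _ => [::]); split=> [s _|x]; [exists s | rewrite inE].
- have l0 : 0 < l by apply: leq_trans Xl.
  have Q0 : 0 < Q by rewrite !muln_gt0 m_gt0 l0.
  have {}X0 : 0 < #|X| by case: X0 => x xX; apply/card_gt0P; exists x.
  have : 0 < 4 * Q ^ 2 * #|X| by rewrite muln_gt0 X0 andbT muln_gt0 expn_gt0 Q0.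
  by rewrite ltnNge hb.
- by exists (fun _ => [::]); split=> [s _|x]; [exists s | rewrite inE].
have {}X0 : 0 < #|X| by case: X0 => x xX; apply/card_gt0P; exists x.
rewrite mulnS addnA in aT.
have aT1 : a + 9 * m * E <= T by apply: leq_trans aT; apply: leq_addr.
have [s [Z [sS ZX [w ww wZ] hZ]]] := batch XA X0 Xl aT1.
have cXZ : #|X :\: Z| = #|X| - #|Z| by rewrite cardsD (setIidPr ZX).
have [||||W [W1 W2]] := IH (a + 9 * m * E) (X :\: Z) => //.
- by apply: fintype.subset_trans XA; apply: subsetDl.
- by apply: leq_ltn_trans Xl; apply/leq_trunc_log/subset_leq_card/subsetDl.
- rewrite cXZ; apply: square_descent hb _; move: hZ; rewrite expnMn; exact.
exists (fun v => if v == s then w ++ W v else W v); split=> [v vS|x xX].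
  have [u hu] := W1 v vS; exists u; case: eqP => [vs|_].
    by rewrite vs in hu *; apply: walk_cat ww hu; rewrite ?leq_addr.
  case: hu => h1 h2 /allP h3; split=> //; apply/allP => t /h3 /andP[t1 ->].
  by rewrite andbT (leq_trans _ t1) // leq_addr.
have [xZ|xZ] := boolP (x \in Z).
  exists s => //; rewrite eqxx; have := wZ x xZ.
  by rewrite /visited map_cat !inE mem_cat => /orP[->//|->]; rewrite orbT.
have [|v vS xv] := W2 x; first by rewrite inE xZ.
exists v => //; case: eqP => [vs|//].
move: xv; rewrite /visited map_cat !inE mem_cat.
by move=> /orP[->//|->]; rewrite !orbT.
Qed.

End Sweep.

(** * Numerical estimates *)

Section Constants.
Variable R : realType.

(** [expR (- (1 / 2))] is at least [1 - 1 / 2]; inverting gives [expR (1 / 2) <= 2]. *)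
Lemma ln2_ge_half : 1 / 2 <= ln 2 :> R.
Proof.
rewrite -ler_expR lnK ?posrE //.
have := expR_ge1Dx (- (1 / 2) : R); rewrite expRN.
have e0 : 0 < expR (1 / 2) :> R := expR_gt0 _.
by rewrite -[expR _ in X in _ -> X]invrK => h; rewrite -[leRHS]invrK lef_pV2 ?posrE ?invr_gt0 //; lra.
Qed.

Lemma log_ge_half (x : R) : 1 / 2 <= log_ x.
Proof.
rewrite /log_; case: ltP => [_|x2]; first lra.
by apply: le_trans ln2_ge_half _; rewrite ler_ln ?posrE //; lra.
Qed.

Lemma trunc_log_le_log k : (0 < k)%N -> (trunc_log 2 k).+1%:R <= 4 * log_ k%:R :> R.
Proof.
move=> k0; rewrite /log_ (ltr_nat R k 2); case: ltnP => [|k2].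
  by case: k k0 => [|[]]//= _ _; rewrite trunc_log1; lra.
have t1 : (1 <= trunc_log 2 k)%N by rewrite trunc_log_max.
have h : (trunc_log 2 k)%:R * ln 2 <= ln k%:R :> R.
  rewrite mulr_natl -lnXn // ler_ln ?posrE ?exprn_gt0 ?ltr0n // -natrX ler_nat.
  exact: trunc_logP.
have t1r : 1 <= (trunc_log 2 k)%:R :> R by rewrite (ler_nat R 1).
by have l2 := ln2_ge_half; rewrite -natr1; nra.
Qed.

Lemma ceil_sqrt (A : nat) : exists b : nat,
  (A <= b ^ 2)%N /\ b%:R <= 1 + Num.sqrt A%:R :> R.
Proof.
have ex : exists b, (A <= b ^ 2)%N.
  by exists A; case: A => // A; rewrite expnS expn1 leq_pmulr.
case: (ex_minnP ex) => b hb bmin; exists b; split=> //.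
case: b hb bmin => [|b] hb bmin; first by rewrite addr_ge0 ?sqrtr_ge0.
have lt : (b ^ 2 < A)%N by rewrite ltnNge; apply/negP => /bmin; rewrite ltnn.
rewrite -natr1 addrC lerD2l -[leLHS]ger0_norm // -sqrtr_sqr ler_sqrt ?ler0n //.
by rewrite -natrX ler_nat ltnW.
Qed.

End Constants.

(** The sweep yields the factor [n * D] for the average degree [D]; this lemma supplies the further
    [sqrt D], which may be below 1. If [#|V| > 2 * E], more than half of the vertices are inactive,
    hence in [S], so [#|V| <= 2 * #|S|], and one factor [m1] is traded for [E]. *)
Lemma active_anchor_count (V : finType) (T : nat) (G : temporal_graph V T) (S : {set V}) :
  (0 < T)%N -> always_connected G S ->
  (#|S :&: active G| ^ 6 * #|V| <= 2 * #|S| ^ 6 * num_arcs G)%N.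
Proof.
move=> T0 GS; set m1 := #|_ :&: _|; set m := #|S|; set E := num_arcs G.
have m1m : (m1 <= m)%N by apply/subset_leq_card/subsetIl.
have nA : (#|active G| <= E)%N := card_active G.
have m1E : (m1 <= E)%N by apply: leq_trans nA; apply/subset_leq_card/subsetIr.
have [nE|En] := leqP #|V| (2 * E).
  rewrite -mulnA mulnCA; by apply: leq_mul => //; rewrite leq_exp2r.
have nm : (#|V| <= 2 * m)%N.
  have : (#|~: active G| <= m)%N.
    apply/subset_leq_card/fintype.subsetP => x; rewrite inE; exact: inactive_anchor.
  by have := cardsC (active G); lia.
apply: (@leq_trans (m ^ 5 * E * (2 * m))%N).
  by apply: leq_mul => //; rewrite expnSr leq_mul // leq_exp2r.
by rewrite leq_eqVlt; apply/orP; left; apply/eqP; ring.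
Qed.

(** * Assembling the bound *)

Theorem theorem1 (R : realType) :
  exists2 C : R, 0 < C &
    forall (V : finType) (T : nat) (G : temporal_graph V T) (S X : {set V}),
      (0 < T)%N ->
      always_connected G S ->
      C * #|V|%:R * #|S|%:R ^+ 3 * avg_degree G R `^ (3 / 2)
        * Num.sqrt (#|X|%:R * log_ (#|S| * #|X|)%:R) * log_ #|X|%:R <= T%:R ->
      explored_by G (fun s : {v : V | v \in S} => val s) X.
Proof.
(* [432 = 9 * 3 * 16] comes from the round length, [ble] and [Q]; [16 = 2 * 4 * 2] comes from [mle],
   [lle] and [sle]. *)
exists (432 * 16) => [|V T G S X T0 GS hT]; first by rewrite mulr_gt0 ?ltr0n.
set A := active G; set X1 := X :&: A; set m1 := #|S :&: A|; set E := num_arcs G.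
(* Inactive vertices of [X] are start vertices, visited at once by their own agents; only [X1] has
   to be swept. *)
have XS x : x \in X -> x \notin X1 -> x \in S.
  by move=> xX; rewrite inE xX; apply: inactive_anchor.
suff [W [W1 W2]] : exists W : V -> seq (step V T),
    (forall s, s \in S -> exists u, walk_within G 0 T s u (W s)) /\
    (forall x, x \in X1 -> exists2 s, s \in S & x \in visited s (W s)).
  exists (fun s => W (val s)); split=> [[s sS]|x xX].
    have [u [h1 h2 _]] := W1 s sS; exists u; split=> //=.
    exact: pairwise_sorted.
  have [/W2[s sS xs]|/(XS x xX) xS] := boolP (x \in X1).
    by exists (exist _ s sS).
  by exists (exist _ x xS); rewrite /visited inE eqxx.
have [->|[x1 x1X]] := set_0Vmem X1.
  by exists (fun _ => [::]); split=> [s _|x]; [exists s | rewrite inE].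
have X10 : (0 < #|X1|)%N by apply/card_gt0P; exists x1.
have m10 : (0 < m1)%N.
  have [|s sS _] := active_anchor GS T0 (x := x1); first by case/setIP: x1X.
  by apply/card_gt0P; exists s.
set l := (trunc_log 2 #|X1|).+1.
set Q := (16 * m1 ^ 2 * l)%N.
have [b [hb hb']] := ceil_sqrt R (4 * Q ^ 2 * #|X1|)%N.
apply: (sweep GS m10 (subsetIr X A) (ltnSn _) hb).
rewrite add0n -(ler_nat R); apply: le_trans hT.
set n := #|V|; set k := #|X|; set m := #|S|; set D := avg_degree G R.
have n0 : 0 < n%:R :> R by rewrite ltr0n; apply/card_gt0P; exists x1.
have DE : n%:R * D = E%:R by rewrite /D /avg_degree -natr_sum mulrC divfK ?gt_eqF.
have D0 : 0 <= D by rewrite /D /avg_degree divr_ge0 ?sumr_ge0.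
have -> : D `^ (3 / 2) = D * Num.sqrt D.
  rewrite -powR12_sqrt // -{2}(powRr1 D0) -powRD; last by apply/implyP; rewrite gt_eqF //; lra.
  by congr (_ `^ _); lra.
have k1k : (#|X1| <= k)%N by apply/subset_leq_card/subsetIl.
have lle : l%:R <= 4 * log_ k%:R :> R.
  apply: le_trans (trunc_log_le_log R (leq_trans X10 k1k)).
  by rewrite ler_nat ltnS leq_trunc_log.
(* The factor 2 makes up for [log_], which can fall below 1 but not below [1 / 2]. *)
have sle : Num.sqrt #|X1|%:R <= 2 * Num.sqrt (k%:R * log_ (m * k)%:R) :> R.
  have -> : 2 = Num.sqrt (2 ^+ 2) :> R by rewrite sqrtr_sqr ger0_norm.
  have lg := log_ge_half ((m * k)%:R : R); have k0 : 0 <= k%:R :> R by [].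
  have k1kr : #|X1|%:R <= k%:R :> R by rewrite ler_nat.
  rewrite -sqrtrM ?exprn_ge0 // ler_sqrt; last by rewrite !mulr_ge0 ?exprn_ge0 //; lra.
  by apply: le_trans k1kr _; nra.
have mle : m1%:R ^+ 3 <= 2 * (m%:R ^+ 3 * Num.sqrt D) :> R.
  have h : m1%:R ^+ 6 * n%:R <= 2 * m%:R ^+ 6 * (n%:R * D) :> R.
    by rewrite DE -!natrX -!natrM ler_nat; apply: active_anchor_count.
  rewrite -(@ler_pXn2r _ 2) ?nnegrE ?exprn_ge0 ?mulr_ge0 ?sqrtr_ge0 //.
  rewrite -exprM.
  have -> : (2 * (m%:R ^+ 3 * Num.sqrt D)) ^+ 2 = 4 * (m%:R ^+ 6 * Num.sqrt D ^+ 2) by ring.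
  rewrite sqr_sqrtr //.
  have {}h : m1%:R ^+ 6 <= 2 * m%:R ^+ 6 * D.
    by rewrite -(ler_pM2r n0); rewrite -[_ * D * _]mulrA [D * _]mulrC.
  by apply: le_trans h _; have := mulr_ge0 (exprn_ge0 6 (ler0n R m)) D0; lra.
(* The 1 lost in rounding up is at most [Q * sqrt #|X1|], which turns the factor 2 into 3. *)
have ble : b%:R <= 3 * (Q%:R * Num.sqrt #|X1|%:R) :> R.
  apply: le_trans hb' _; rewrite (natrM _ (4 * Q ^ 2)) (natrM _ 4) natrX.
  have -> : 4 * Q%:R ^+ 2 * #|X1|%:R = (2 * Q%:R) ^+ 2 * #|X1|%:R :> R by ring.
  rewrite sqrtrM ?exprn_ge0 ?mulr_ge0 // sqrtr_sqr ger0_norm ?mulr_ge0 //.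
  have Q1 : 1 <= Q%:R :> R by rewrite (ler_nat R 1) !muln_gt0 m10.
  have s1 : 1 <= Num.sqrt #|X1|%:R :> R.
    by rewrite -[leLHS]sqrtr1 ler_wsqrtr // ler1n.
  by nra.
rewrite (natrM _ (9 * m1 * E)) (natrM _ (9 * m1)) (natrM _ 9).
apply: le_trans (_ : 432 * (E%:R * (m1%:R ^+ 3 * (l%:R * Num.sqrt #|X1|%:R))) <= _).
  apply: le_trans (ler_wpM2l _ ble) _; first by rewrite !mulr_ge0.
  by rewrite /Q (natrM _ (16 * m1 ^ 2)) (natrM _ 16) natrX le_eqVlt; apply/orP; left; apply/eqP; ring.
have -> : 432 * 16 * n%:R * m%:R ^+ 3 * (D * Num.sqrt D) * Num.sqrt (k%:R * log_ (m * k)%:R)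
    * log_ k%:R = 432 * (E%:R * (2 * (m%:R ^+ 3 * Num.sqrt D)
    * (4 * log_ k%:R * (2 * Num.sqrt (k%:R * log_ (m * k)%:R))))) by rewrite -DE; ring.
do 2![apply: ler_wpM2l; first exact: ler0n].
apply: ler_pM mle _; [by rewrite exprn_ge0 | by rewrite mulr_ge0 ?sqrtr_ge0 |].
by apply: ler_pM lle sle; [exact: ler0n | exact: sqrtr_ge0].
Qed.
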